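(* Let $\mathcal{X}$ be a finite nonempty set. A subspace of $(\mathrm{DMC}_{\mathcal{X},\ast}^{(o)},\mathcal{T}_{s,\mathcal{X},\ast}^{(o)})$, where $\mathcal{T}_{s,\mathcal{X},\ast}^{(o)}$ is the strong topology, is compact if and only if it is rank-bounded and strongly closed.
   Context: For finite nonempty sets $\mathcal{X},\mathcal{Y}$, $\mathrm{DMC}_{\mathcal{X},\mathcal{Y}}$ is the set of channels from $\mathcal{X}$ to $\mathcal{Y}$, i.e. functions $W:\mathcal{X}\times\mathcal{Y}\to[0,1]$, written $W(y|x)$, with $\sum_{y\in\mathcal{Y}}W(y|x)=1$ for every $x\in\mathcal{X}$. It carries the topology $\mathcal{T}_{\mathcal{X},\mathcal{Y}}$ inherited from the Euclidean topology of $\mathbb{R}^{\mathcal{X}\times\mathcal{Y}}$. For $W\in\mathrm{DMC}_{\mathcal{X},\mathcal{Y}}$ and $V\in\mathrm{DMC}_{\mathcal{Y},\mathcal{Z}}$, the composition $V\circ W\in\mathrm{DMC}_{\mathcal{X},\mathcal{Z}}$ is $(V\circ W)(z|x)=\sum_{y\in\mathcal{Y}}V(z|y)W(y|x)$. A channel $W'\in\mathrm{DMC}_{\mathcal{X},\mathcal{Z}}$ is degraded from $W\in\mathrm{DMC}_{\mathcal{X},\mathcal{Y}}$ if $W'=V\circ W$ for some $V\in\mathrm{DMC}_{\mathcal{Y},\mathcal{Z}}$; $W$ and $W'$ are equivalent if each is degraded from the other. Let $[n]=\{1,\dots,n\}$, let $\mathrm{DMC}_{\mathcal{X},\ast}=\coprod_{n\ge1}\mathrm{DMC}_{\mathcal{X},[n]}$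 with the disjoint union topology $\bigoplus_{n\ge1}\mathcal{T}_{\mathcal{X},[n]}$, and let $\mathrm{DMC}_{\mathcal{X},\ast}^{(o)}$ be the quotient of $\mathrm{DMC}_{\mathcal{X},\ast}$ by equivalence of channels. The strong topology $\mathcal{T}_{s,\mathcal{X},\ast}^{(o)}$ is the quotient topology on $\mathrm{DMC}_{\mathcal{X},\ast}^{(o)}$; ''strongly closed'' means closed in this topology. For $n\ge1$, $\mathrm{DMC}_{\mathcal{X},[n]}^{(o)}$ is regarded as the subset of $\mathrm{DMC}_{\mathcal{X},\ast}^{(o)}$ consisting of the classes containing a channel with output alphabet $[n]$. A subset $A$ of $\mathrm{DMC}_{\mathcal{X},\ast}^{(o)}$ is rank-bounded if $A\subset\mathrm{DMC}_{\mathcal{X},[n]}^{(o)}$ for some $n\ge1$. *)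

(* Defs.v *)
From HB Require Import structures.
From mathcomp Require Import all_boot all_order all_algebra.
From mathcomp Require Import all_classical all_reals all_analysis.

Set Implicit Arguments.
Unset Strict Implicit.
Unset Printing Implicit Defensive.

Import Order.TTheory GRing.Theory Num.Theory.
Import numFieldNormedType.Exports.

Local Open Scope classical_set_scope.
Local Open Scope ring_scope.
Local Open Scope quotient_scope.

(* [W (x, y)] stands for W(y|x); since [X * Y] is finite, the product topology
   is the Euclidean topology of R^(X * Y). *)
Definition channel (R : realType) (X Y : finType) :
    set (prod_topology (fun _ : X * Y => R)) :=
  [set W | (forall xy, 0 <= W xy <= 1) /\
           (forall x, \sum_(y : Y) W (x, y) = 1)].

Definition DMC (R : realType) (X Y : finType) : Type := @channel R X Y.

HB.instance Definition _ (R : realType) (X Y : finType) :=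
  Topological.copy (DMC R X Y) (set_type (@channel R X Y)).

Definition prob (R : realType) (X Y : finType) (W : DMC R X Y) (y : Y) (x : X)
  : R := set_val W (x, y).

Section channel_theory.
Context {R : realType}.
Implicit Types X Y Z T : finType.

Lemma prob_ge0 X Y (W : DMC R X Y) y x : 0 <= prob W y x.
Proof. by have [/(_ (x, y))/andP[]] := set_valP W. Qed.

Lemma prob_sum1 X Y (W : DMC R X Y) x : \sum_y prob W y x = 1.
Proof. by have [_ /(_ x)] := set_valP W. Qed.

Lemma DMC_eqP X Y (W W' : DMC R X Y) :
  (forall x y, prob W y x = prob W' y x) -> W = W'.
Proof. by move=> WW'; apply: val_inj; apply/funext => -[x y]; exact: WW'. Qed.

Lemma channelP X Y (f : X * Y -> R) : (forall xy, 0 <= f xy) ->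
  (forall x, \sum_y f (x, y) = 1) -> channel f.
Proof.
move=> f0 f1; split => // -[x y]; rewrite f0/= -(f1 x) (bigD1 y)//=.
by rewrite lerDl sumr_ge0.
Qed.

Lemma compose_subproof X Y Z (V : DMC R Y Z) (W : DMC R X Y) :
  channel (fun xz : X * Z => \sum_y prob V xz.2 y * prob W y xz.1).
Proof.
apply: channelP => [xz|x].
  by apply: sumr_ge0 => y _; rewrite mulr_ge0 ?prob_ge0.
rewrite exchange_big/= -[RHS](prob_sum1 W x); apply: eq_bigr => y _.
by rewrite -mulr_suml prob_sum1 mul1r.
Qed.

Definition compose X Y Z (V : DMC R Y Z) (W : DMC R X Y) : DMC R X Z :=
  SigSub (mem_set (compose_subproof V W)).

Definition degraded X Y Z (W' : DMC R X Z) (W : DMC R X Y) : Prop :=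
  exists V : DMC R Y Z, W' = compose V W.

Definition equivalent X Y Z (W : DMC R X Y) (W' : DMC R X Z) : Prop :=
  degraded W' W /\ degraded W W'.

Lemma probM X Y Z (V : DMC R Y Z) (W : DMC R X Y) z x :
  prob (compose V W) z x = \sum_y prob V z y * prob W y x.
Proof. by []. Qed.

Lemma id_channel_subproof X : channel (fun xy : X * X => (xy.1 == xy.2)%:R : R).
Proof.
apply: channelP => [xy|x]; first by rewrite ler0n.
rewrite (bigD1 x)//= eqxx big1 ?addr0// => y.
by rewrite eq_sym => /negbTE ->.
Qed.

Definition id_channel X : DMC R X X := SigSub (mem_set (id_channel_subproof X)).

Lemma prob_id X (x x' : X) : prob (id_channel X) x' x = (x == x')%:R.
Proof. by []. Qed.

Lemma compose_id X Y (W : DMC R X Y) : compose (id_channel Y) W = W.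
Proof.
apply: DMC_eqP => x y; rewrite probM (bigD1 y)//= prob_id eqxx mul1r.
by rewrite big1 ?addr0// => z /negbTE zy; rewrite prob_id zy mul0r.
Qed.

Lemma composeA X Y Z T (U : DMC R Z T) (V : DMC R Y Z) (W : DMC R X Y) :
  compose U (compose V W) = compose (compose U V) W.
Proof.
apply: DMC_eqP => x t; rewrite !probM.
under eq_bigr do rewrite probM mulr_sumr.
rewrite exchange_big; apply: eq_bigr => y _ /=.
by rewrite probM mulr_suml; apply: eq_bigr => z _; rewrite mulrA.
Qed.

Lemma degraded_refl X Y (W : DMC R X Y) : degraded W W.
Proof. by exists (id_channel Y); rewrite compose_id. Qed.

Lemma degraded_trans X Y Z T (W : DMC R X Y) (W' : DMC R X Z)
    (W'' : DMC R X T) :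
  degraded W' W -> degraded W'' W' -> degraded W'' W.
Proof. by move=> [V ->] [V' ->]; exists (compose V' V); rewrite composeA. Qed.

End channel_theory.

(* The index [n] stands for the alphabet [n + 1], so that the coproduct ranges
   over all nonempty output alphabets. *)
Definition DMCstar (R : realType) (X : finType) : Type :=
  {n : nat & DMC R X 'I_n.+1}.

HB.instance Definition _ (R : realType) (X : finType) :=
  Topological.copy (DMCstar R X) {n : nat & DMC R X 'I_n.+1}.

Definition equivalentb (R : realType) (X : finType) : rel (DMCstar R X) :=
  fun W W' => `[< equivalent (projT2 W) (projT2 W') >].

Section equivalentb_equiv.
Variables (R : realType) (X : finType).

Lemma equivalentb_refl : reflexive (@equivalentb R X).
Proof. by move=> W; apply/asboolP; split; exact: degraded_refl. Qed.

Lemma equivalentb_sym : symmetric (@equivalentb R X).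
Proof. by move=> W W'; apply/asboolP/asboolP => -[]. Qed.

Lemma equivalentb_trans : transitive (@equivalentb R X).
Proof.
move=> V U W /asboolP[VU UV] /asboolP[WV VW]; apply/asboolP; split.
  exact: degraded_trans VU WV.
exact: degraded_trans VW UV.
Qed.

Canonical equivalentb_equiv :=
  EquivRel (@equivalentb R X) equivalentb_refl equivalentb_sym
    equivalentb_trans.

End equivalentb_equiv.

(* Carries the strong topology. *)
Definition DMCo (R : realType) (X : finType) : Type :=
  quotient_topology {eq_quot (@equivalentb R X)}.

HB.instance Definition _ (R : realType) (X : finType) :=
  Topological.copy (DMCo R X)
    (quotient_topology {eq_quot (@equivalentb R X)}).
HB.instance Definition _ (R : realType) (X : finType) :=
  Quotient.copy (DMCo R X)
    (quotient_topology {eq_quot (@equivalentb R X)}).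

(* Classes containing a channel with output alphabet [n + 1]. *)
Definition DMCo_at (R : realType) (X : finType) (n : nat) : set (DMCo R X) :=
  [set c | exists W : DMC R X 'I_n.+1,
      \pi_(DMCo R X) (existT (fun k => DMC R X 'I_k.+1) n W) = c].
Arguments DMCo_at : clear implicits.

Definition rank_bounded (R : realType) (X : finType) (A : set (DMCo R X)) :
    Prop :=
  exists n : nat, A `<=` DMCo_at R X n.

(* Main.v *)
Require Import Defs.
From mathcomp Require Import all_boot all_order all_algebra.
From mathcomp Require Import all_classical all_reals all_analysis.

(** The spaces DMC_{X,[n]} are compact Hausdorff and composition of channels is
    continuous, so saturating a closed set of channels by equivalence is a
    projection of a closed set along a compact factor.  Hence each projection
    DMC_{X,[n]} -> DMC_{X,*}^(o) is a closed map.

    Let A be compact.  If a channel W is in the closure of the preimage of A,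
    then by compactness the classes of channels of that preimage approaching W
    cluster at some c in A; closedness of the projection shows that every
    closed neighbourhood of W meets the closed fibre over c, so W is in it by
    regularity, and the preimage of A is closed.  If A were not rank-bounded,
    there would be a_k in A outside DMC_{X,[k]}^(o); every tail of (a_k) meets
    each DMC_{X,[n]}^(o) in finitely many closed points, hence is closed, and a
    cluster point of (a_k) would be equal to a_k for arbitrarily large k, which
    puts it outside every DMC_{X,[k]}^(o).

    Conversely, a closed set inside DMC_{X,[n]}^(o) is the image of its preimage
    in DMC_{X,[n]}, which is closed, hence compact. *)

Set Implicit Arguments.
Unset Strict Implicit.
Unset Printing Implicit Defensive.

Import Order.TTheory GRing.Theory Num.Theory.
Import numFieldNormedType.Exports.

Local Open Scope classical_set_scope.
Local Open Scope ring_scope.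
Local Open Scope quotient_scope.

(** * Continuity into products and closed equalizers *)

Lemma prod_topology_continuous (T : topologicalType) (I : Type)
    (K : I -> topologicalType) (f : T -> prod_topology K) :
  (forall i, continuous (fun t => f t i)) -> continuous f.
Proof.
move=> fc t; apply/cvg_sup => i U [V [[B oB <-] Bft] BU].
apply: filterS BU _; exact: (fc i t _ (open_nbhs_nbhs (conj oB Bft))).
Qed.

Lemma closed_eqfun (T U : topologicalType) (f g : T -> U) :
  hausdorff_space U -> continuous f -> continuous g ->
  closed [set t | f t = g t].
Proof.
move=> hU fc gc t clt; apply: hU => A B fA gB.
have /clt[s [fgs [As Bs]]] : nbhs t (f @^-1` A `&` g @^-1` B).
  by apply: filterI; [exact: fc|exact: gc].
by exists (f s); split => //; rewrite fgs.
Qed.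

(** * Topology of the spaces of channels *)

Section channel_topology.
Context {R : realType}.
Implicit Types X Y Z : finType.

Lemma DMC_continuous X Y (T : topologicalType) (f : T -> DMC R X Y) :
  (forall x y, continuous (fun t => prob (f t) y x)) -> continuous f.
Proof.
move=> fc; apply: continuous_comp_initial.
by apply: prod_topology_continuous => -[x y]; exact: fc.
Qed.

Lemma prob_continuous X Y x y :
  continuous (fun W : DMC R X Y => prob W y x).
Proof.
move=> W; apply: (@continuous_comp (DMC R X Y)
  (prod_topology (fun _ : X * Y => R)) R set_val (fun g => g (x, y)) W);
  last exact: (@proj_continuous _ (fun=> R)).
exact: initial_continuous.
Qed.

Lemma compact_channel X Y : compact (@channel R X Y).
Proof.
have C01 := @tychonoff (X * Y)%type (fun=> R) (fun=> `[0, 1]%classic)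
  (fun=> @segment_compact R 0 1).
apply: (subclosed_compact _ C01); last first.
  by move=> W [W01 _] xy /=; rewrite in_itv /= W01.
have pc xy : continuous (fun W : prod_topology (fun _ : X * Y => R) => W xy).
  exact: (@proj_continuous _ (fun=> R) xy).
rewrite (_ : @channel R X Y =
  (\bigcap_xy [set W | 0 <= W xy <= 1]) `&`
  (\bigcap_x [set W : prod_topology (fun _ : X * Y => R) |
      \sum_(y : Y) W (x, y) = 1])).
  apply: closedI; apply: closed_bigI.
    move=> xy _; rewrite (_ : [set W | _] = (fun W => W xy) @^-1` `[0, 1]).
      by apply: (continuous_closedP _).1 => //; exact: interval_closed.
    by apply/seteqP; split=> W /=; rewrite in_itv.
  move=> x _; rewrite (_ : [set W | _] =
    (fun W : prod_topology (fun _ : X * Y => R) =>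
       \sum_(y : Y) W (x, y)) @^-1` [set 1]) //.
  apply: (continuous_closedP _).1; last exact: closed_eq.
  by apply: continuous_big => [|y _]; [exact: add_continuous|exact: pc].
apply/seteqP; split=> W /=.
  by move=> [W01 W1]; split => ? _; [exact: W01|exact: W1].
by move=> [W01 W1]; split => ?; [exact: W01|exact: W1].
Qed.

(** A cluster point taken in the ambient product lies in [channel], and the open sets of [DMC] are
    traces of open sets of that product. *)
Lemma compact_DMC X Y : compact [set: DMC R X Y].
Proof.
move=> F FF _.
have FC : F (set_val @^-1` @channel R X Y).
  by apply: filterE => W; exact: set_valP.
have [g [Cg clg]] := @compact_channel X Y (set_val @ F) _ FC.
exists (SigSub (mem_set Cg)); split => // A B FA [_ [[U oU <-] Ug] UB].
have [_ [[W AW <-] UW]] : (set_val @` A) `&` U !=set0.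
  by apply: clg; [exact: filterS (@preimage_image _ _ _ _) FA
                 |exact: open_nbhs_nbhs].
by exists W; split => //; exact: UB.
Qed.

Lemma hausdorff_DMC X Y : hausdorff_space (DMC R X Y).
Proof.
move=> V W VW; apply: val_inj.
apply: (@hausdorff_product _ (fun _ : X * Y => R) (fun=> @Rhausdorff R)).
move=> A B /initial_continuous VA /initial_continuous WB.
by have [U [AU BU]] := VW _ _ VA WB; exists (set_val U).
Qed.

Lemma compose_continuous X Y Z :
  continuous (fun p : DMC R Y Z * DMC R X Y => compose p.1 p.2).
Proof.
apply: DMC_continuous => x z [V W].
apply: cvg_big => [|y _]; first exact: add_continuous.
apply: cvgM.
  apply: (@cvg_comp _ _ _ fst (fun V : DMC R Y Z => prob V z y)).
    exact: cvg_fst.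
  exact: prob_continuous.
apply: (@cvg_comp _ _ _ snd (fun W : DMC R X Y => prob W y x)).
  exact: cvg_snd.
exact: prob_continuous.
Qed.

Lemma deterministic_subproof Y Z (f : Y -> Z) :
  channel (fun yz : Y * Z => (f yz.1 == yz.2)%:R : R).
Proof.
apply: channelP => [yz|y]; first exact: ler0n.
rewrite (bigD1 (f y))//= eqxx big1 ?addr0// => z.
by rewrite eq_sym => /negbTE ->.
Qed.

(** A function seen as a noiseless channel; it serves to embed an alphabet in a larger one and to
    retract onto it. *)
Definition deterministic Y Z (f : Y -> Z) : DMC R Y Z :=
  SigSub (mem_set (deterministic_subproof f)).

Lemma prob_deterministic Y Z (f : Y -> Z) y z :
  prob (deterministic f) z y = (f y == z)%:R.
Proof. by []. Qed.

Lemma prob_compose_deterministic X Y Z (V : DMC R Y Z) (f : X -> Y) x z :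
  prob (compose V (deterministic f)) z x = prob V z (f x).
Proof.
rewrite probM (bigD1 (f x))//= prob_deterministic eqxx mulr1.
rewrite big1 ?addr0// => y; rewrite prob_deterministic eq_sym => /negbTE ->.
by rewrite mulr0.
Qed.

Lemma closed_saturation X Y Z (K : set (DMC R X Y)) : closed K ->
  closed [set U : DMC R X Z | exists2 W, K W & equivalent W U].
Proof.
move=> Kc.
(* Points are read as [(U, (W, (V, V')))]; in [C] below, [V] and [V'] witness that [U] and [W] are
   degraded from each other. *)
pose T : topologicalType :=
  (DMC R X Z * (DMC R X Y * (DMC R Y Z * DMC R Z Y)))%type.
have f1 : continuous (fun t : T => t.1) by move=> t; exact: cvg_fst.
have f2 : continuous (fun t : T => t.2) by move=> t; exact: cvg_snd.
have f21 : continuous (fun t : T => t.2.1).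
  by move=> t; exact: cvg_comp (f2 t) cvg_fst.
have f22 : continuous (fun t : T => t.2.2).
  by move=> t; exact: cvg_comp (f2 t) cvg_snd.
have f221 : continuous (fun t : T => t.2.2.1).
  by move=> t; exact: cvg_comp (f22 t) cvg_fst.
have f222 : continuous (fun t : T => t.2.2.2).
  by move=> t; exact: cvg_comp (f22 t) cvg_snd.
pose C : set T := [set t | K t.2.1] `&`
  ([set t | t.1 = compose t.2.2.1 t.2.1] `&`
   [set t | t.2.1 = compose t.2.2.2 t.1]).
have Cc : closed C.
  apply: closedI; first exact: (continuous_closedP _).1.
  apply: closedI; apply: closed_eqfun => //; try exact: hausdorff_DMC.
    by move=> t; exact: cvg_comp (cvg_pair (f221 t) (f21 t))
      (@compose_continuous _ _ _ (t.2.2.1, t.2.1)).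
  by move=> t; exact: cvg_comp (cvg_pair (f222 t) (f1 t))
    (@compose_continuous _ _ _ (t.2.2.2, t.1)).
have compactT : compact [set: T].
  by rewrite -!setXTT; do !apply: compact_setX; exact: compact_DMC.
rewrite (_ : [set U | _] = fst @` C).
  apply: compact_closed; first exact: hausdorff_DMC.
  apply: continuous_compact; first exact: continuous_subspaceT.
  exact: subclosed_compact compactT _.
apply/seteqP; split => [U [W KW [[V UE] [V' WE]]]|U].
  by exists (U, (W, (V, V'))).
move=> [[{}U [W [V V']]] [/= KW [UE WE]] <-].
by exists W => //; split; [exists V|exists V'].
Qed.

End channel_topology.

(** * Closed and compact sets in the strong topology *)

Section strong_topology.
Context {R : realType} {X : finType}.

Definition channel_class n (W : DMC R X 'I_n.+1) : DMCo R X :=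
  \pi_(DMCo R X) (existT (fun k => DMC R X 'I_k.+1) n W).

Lemma channel_class_eq m n (V : DMC R X 'I_m.+1) (W : DMC R X 'I_n.+1) :
  channel_class V = channel_class W <-> equivalent V W.
Proof.
split=> [/eqmodP/asboolP//|VW].
by apply/eqmodP/asboolP.
Qed.

Lemma channel_class_continuous n : continuous (@channel_class n).
Proof.
move=> W; apply: (@continuous_comp _ (DMCstar R X) (DMCo R X)
  (existT (fun k => DMC R X 'I_k.+1) n) \pi).
  exact: existT_continuous.
exact: pi_continuous.
Qed.

Lemma closed_DMCoP (A : set (DMCo R X)) :
  closed A <-> forall n, closed (@channel_class n @^-1` A).
Proof.
split=> [cA n|cA].
  exact: (continuous_closedP _).1 (@channel_class_continuous n) _ cA.
rewrite -openC; apply: (sigT_openP _).2 => n.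
exact: closed_openC (cA n).
Qed.

(** On each summand, the preimage of the image of [K] is the saturation of [K] by equivalence. *)
Lemma channel_class_closed_map n (K : set (DMC R X 'I_n.+1)) :
  closed K -> closed (@channel_class n @` K).
Proof.
move=> Kc; apply/closed_DMCoP => m.
rewrite (_ : _ @^-1` _ = [set U | exists2 W, K W & equivalent W U]).
  exact: closed_saturation.
by apply/seteqP; split => U [W KW /channel_class_eq]; exists W => //;
  exact/channel_class_eq.
Qed.

Lemma channel_class_surj (c : DMCo R X) : exists n W, @channel_class n W = c.
Proof.
exists (projT1 (repr c)), (projT2 (repr c)).
by rewrite /channel_class -sigT_eta reprK.
Qed.

Lemma closed_DMCo1 (c : DMCo R X) : closed [set c].
Proof.
have [n [W <-]] := channel_class_surj c; rewrite -image_set1.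
apply/channel_class_closed_map/accessible_closed_set1/hausdorff_accessible.
exact: hausdorff_DMC.
Qed.

Lemma compact_DMCo_closed (A : set (DMCo R X)) : compact A -> closed A.
Proof.
move=> cA; apply/closed_DMCoP => n W clW.
pose F := within (@channel_class n @^-1` A) (nbhs W).
have PF : ProperFilter F by apply: within_nbhs_proper.
have [|c [Ac cFc]] := cA (@channel_class n @ F) _.
  exact: withinT.
apply: contrapT => nAW.
have oc : open (@channel_class n @^-1` ~` [set c]).
  exact: closed_openC ((closed_DMCoP _).1 (@closed_DMCo1 c) n).
have Wc : (@channel_class n @^-1` ~` [set c]) W.
  by move=> Wc; apply: nAW; rewrite /= Wc.
(* The fibre over [c] is closed and misses [W], so some neighbourhood [N] of [W] has a closure that
   misses it. *)
have [N WN clN] := compact_regular (@hausdorff_DMC R X _) (@compact_DMC R X _)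
  (@filterT _ (nbhs W) _) (open_nbhs_nbhs (conj oc Wc)).
(* The image of [closure N] is closed and belongs to the filter that clusters at [c]. *)
have [V /clN Vc Vc'] : (@channel_class n @` closure N) c.
  apply: channel_class_closed_map (@closed_closure _ _) _ _.
  move: cFc; rewrite clusterE; apply.
  apply: filterS WN => V NV _; exists V => //; exact: subset_closure.
exact: Vc.
Qed.

Lemma DMCo_at_mono m n : (m <= n)%N -> DMCo_at R X m `<=` DMCo_at R X n.
Proof.
move=> mn c [W <-].
pose e := @deterministic R _ _ (widen_ord (mn : m.+1 <= n.+1)%N).
(* [inord] sends the letters beyond [m] to a default letter; [r] still undoes [e]. *)
pose r := @deterministic R _ _ (fun i : 'I_n.+1 => inord i : 'I_m.+1).
exists (compose e W); apply/channel_class_eq; split; last by exists e.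
exists r; rewrite composeA -[LHS]compose_id; congr compose.
apply: DMC_eqP => i j.
by rewrite prob_compose_deterministic prob_deterministic prob_id inord_val.
Qed.

Lemma compact_DMCo_rank_bounded (A : set (DMCo R X)) :
  compact A -> rank_bounded A.
Proof.
move=> cA; apply: contrapT => nrb.
have /choice[a aP] n : exists c, A c /\ ~ DMCo_at R X n c.
  apply: contrapT => nc; apply: nrb; exists n => c Ac.
  by apply: contrapT => nn; apply: nc; exists c.
have FA : (a @ \oo) A by exists 0%N => // n _; exact: (aP n).1.
have [c [_ cac]] := cA _ _ FA.
have [n [W Wc]] := channel_class_surj c.
(* The tail starts at an index [n] whose summand contains a representative of [c]. *)
pose S := a @` [set k | (n <= k)%N].
have Scl : closed S.
  apply/closed_DMCoP => m.
  (* Since [a k] is outside [DMCo_at R X k], a class in [DMCo_at R X m] can equal [a k] only for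
     [k < m]; the union is finite. *)
  rewrite (_ : _ @^-1` _ =
      \bigcup_(k in [set k | (n <= k < m)%N])
        (@channel_class m @^-1` [set a k])).
    apply: closed_bigcup => [|k _].
      by apply: (@sub_finite_set _ _ `I_m) => [k /andP[]//|]; exact: finite_II.
    exact: (closed_DMCoP _).1 (@closed_DMCo1 (a k)) m.
  apply/seteqP; split => V.
    move=> [k nk ak]; exists k => //=; rewrite nk ltnNge; apply/negP => mk.
    by apply: (aP k).2; apply: DMCo_at_mono mk _ _; exists V.
  by move=> [k /= /andP[nk _] ->]; exists k.
have [k nk akc] : S c.
  apply: Scl; move: cac; rewrite clusterE; apply.
  by exists n => // k nk; exists k.
by apply: (aP k).2; apply: DMCo_at_mono nk _ _; exists W; rewrite akc.
Qed.

End strong_topology.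

Theorem proposition10 (R : realType) (X : finType) (hX : (0 < #|X|)%N)
    (A : set (DMCo R X)) :
  compact A <-> rank_bounded A /\ closed A.
Proof.
split=> [cA|[[n An] Acl]].
  by split; [exact: compact_DMCo_rank_bounded|exact: compact_DMCo_closed].
(* Rank-boundedness gives every class of [A] a representative in the summand of index [n]. *)
rewrite (_ : A = @channel_class R X n @` (@channel_class R X n @^-1` A)).
  apply: continuous_compact.
    by apply: continuous_subspaceT; exact: channel_class_continuous.
  apply: subclosed_compact (@compact_DMC R X _) _ => //.
  exact: (closed_DMCoP _).1 Acl n.
apply/seteqP; split=> [c Ac|_ [W AW <-]//].
by have [W Wc] := An _ Ac; exists W => //=; rewrite /channel_class Wc.
Qed.
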